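(* Let $n\geq 13$, let $S_n$ be the symmetric group of degree $n$, let $S=\{c_n=(1\ 2\ \cdots\ n),c_n^{-1},(1\ 2)\}$, and let $\Gamma_n=\mathrm{Cay}(S_n,S)$. Then $$\mathrm{Aut}(\Gamma_n)=R(S_n)\rtimes\mathrm{Aut}(S_n,S)=R(S_n)\rtimes\langle\mathrm{Inn}(\phi)\rangle\cong S_n\rtimes\mathbb{Z}_2,$$ where $\phi=(1\ 2)(3\ n)(4\ n-1)(5\ n-2)\cdots\in S_n$ is the permutation with $\phi(1)=2$, $\phi(2)=1$, $\phi(i)=n+3-i$ for $3\le i\le n$, and $\mathrm{Inn}(\phi)$ is the inner automorphism of $S_n$ given by conjugation by $\phi$.
   Context: For a finite group $G$ and a subset $S\subseteq G$ with $e\notin S$ and $S=S^{-1}$, the Cayley graph $\mathrm{Cay}(G,S)$ is the undirected graph with vertex set $G$ in which $g,h$ are adjacent iff $hg^{-1}\in S$; $\mathrm{Aut}(\mathrm{Cay}(G,S))$ denotes its full automorphism group. The right regular representation of $G$ is $R(G)=\{r_g:x\mapsto xg\mid g\in G\}$, a subgroup of $\mathrm{Aut}(\mathrm{Cay}(G,S))$. $\mathrm{Aut}(G,S)=\{\sigma\in\mathrm{Aut}(G): S^\sigma=S\}$, which acts on $G$ and hence is regarded as a subgroup of $\mathrm{Aut}(\mathrm{Cay}(G,S))$ fixing $e$. *)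

(* Defs.v *)
From mathcomp Require Import all_boot all_fingroup zmodp.

Set Implicit Arguments.
Unset Strict Implicit.
Unset Printing Implicit Defensive.

Local Open Scope group_scope.

Section Graph.

Variable T : finType.

Definition graph_aut (e : rel T) : {set {perm T}} :=
  [set p : {perm T} | [forall x, forall y, e (p x) (p y) == e x y]].

Lemma graph_autP e (p : {perm T}) :
  reflect (forall x y, e (p x) (p y) = e x y) (p \in graph_aut e).
Proof.
rewrite inE; apply: (iffP forallP) => H x; last by apply/forallP => y; rewrite H.
by move=> y; move/forallP/(_ y)/eqP: (H x).
Qed.

Lemma graph_aut_group_set e : group_set (graph_aut e).
Proof.
apply/group_setP; split=> [|p q /graph_autP Hp /graph_autP Hq].
  by apply/graph_autP => x y; rewrite !perm1.
by apply/graph_autP => x y; rewrite !permM Hq Hp.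
Qed.

Canonical graph_aut_group e := Group (graph_aut_group_set e).

End Graph.

Section Cayley.

Variable gT : finGroupType.
Implicit Types S : {set gT}.

Definition cayley S : rel gT := fun g h => h * g^-1 \in S.

Lemma cayley_irrefl S : 1 \notin S -> irreflexive (cayley S).
Proof. by move=> S1 g; rewrite /cayley mulgV (negPf S1). Qed.

Lemma cayley_sym S : S^-1 = S -> symmetric (cayley S).
Proof. by move=> SV g h; rewrite /cayley -{1}SV inE invMg invgK. Qed.

(* [perm (mulIg g)] is the permutation [x |-> x * g]. *)
Definition right_regular : {set {perm gT}} :=
  [set perm (@mulIg gT g) | g : gT].

Lemma right_regular_group_set : group_set right_regular.
Proof.
apply/group_setP; split=> [|_ _ /imsetP[g _ ->] /imsetP[h _ ->]].
  by apply/imsetP; exists 1 => //; apply/permP => x; rewrite perm1 permE mulg1.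
apply/imsetP; exists (g * h) => //.
by apply/permP => x; rewrite permM !permE mulgA.
Qed.

Canonical right_regular_group := Group right_regular_group_set.

Definition Aut_stab S : {set {perm gT}} :=
  [set s in Aut [set: gT] | s @: S == S].

Lemma Aut_stab_group_set S : group_set (Aut_stab S).
Proof.
apply/group_setP; split=> [|p q].
  rewrite inE group1 -[X in _ == X]imset_id.
  by apply/eqP/eq_imset => x; rewrite perm1.
rewrite ![_ \in Aut_stab S]inE => /andP[Ap /eqP Sp] /andP[Aq /eqP Sq].
rewrite groupM //=; apply/eqP; rewrite -[RHS]Sq -[in RHS]Sp -imset_comp.
by apply: eq_imset => x; rewrite /= permM.
Qed.

Canonical Aut_stab_group S := Group (Aut_stab_group_set S).

End Cayley.

Section Involution.

(* The action of [Z_2] on [gT] whose generator acts as conjugation by [t],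
   for [t] with [t ^+ 2 = 1]. *)
Variables (gT : finGroupType) (t : gT) (t2 : t ^+ 2 = 1).

Definition Z2_conj (x : gT) (a : 'Z_2) : gT := x ^ (t ^+ a).

Lemma Z2_conj_is_action : is_action [set: 'Z_2] Z2_conj.
Proof.
apply: is_total_action => [x | x a b]; first by rewrite /Z2_conj expg0 conjg1.
by rewrite /Z2_conj -conjgM -expgD /= expg_mod.
Qed.

Canonical Z2_conj_action := Action Z2_conj_is_action.

Lemma Z2_conj_is_groupAction : is_groupAction [set: gT] Z2_conj_action.
Proof.
move=> a _; rewrite inE; apply/andP; split.
  by apply/subsetP => x _; rewrite inE.
by apply/morphicP => x y _ _; rewrite !actpermE /= /Z2_conj conjMg.
Qed.

Canonical Z2_conj_groupAction := GroupAction Z2_conj_is_groupAction.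

End Involution.

(* The points 1, ..., n are represented by the ordinals 0, ..., n - 1. *)
Section Symmetric.

Variable n : nat.

Definition ncycle : 'S_n := perm (@ordS_inj n).

(* The transposition (1 2); the second branch is only reached when n < 2. *)
Definition transp12 : 'S_n :=
  if n is m.+2 return 'S_n then tperm (inord 0) (inord 1) else 1.

Definition conn_set : {set 'S_n} := [set ncycle; ncycle^-1; transp12].

(* phi(i) = n + 3 - i on {3, ..., n} reads i |-> n + 1 - i on {2, ..., n - 1}.
   For n >= 2 the value always lies in 'I_n, so that [insubd] never defaults. *)
Definition phi_fun (i : 'I_n) : 'I_n :=
  insubd i (if i < 2 then 1 - i else n + 1 - i).

Lemma val_phi_fun (i : 'I_n) :
  1 < n -> phi_fun i = (if i < 2 then 1 - i else n + 1 - i) :> nat.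
Proof.
move=> n2; rewrite val_insubd ifT //; have lin := ltn_ord i.
case: (ltnP i 2) => i2; first exact: leq_ltn_trans (leq_subr _ _) n2.
rewrite ltn_subLR; last by rewrite (leq_trans (ltnW lin)) ?leq_addr.
by rewrite addnC ltn_add2r.
Qed.

Lemma phi_funK : involutive phi_fun.
Proof.
case: (ltnP 1 n) => n2 i; apply: val_inj => /=; last first.
  have lin := ltn_ord i; have/eqP i0: i == 0 :> nat.
    by rewrite -leqn0 -ltnS (leq_trans lin).
  have E (j : 'I_n) : j = i.
    apply: val_inj => /=; apply/eqP; rewrite i0 -leqn0 -ltnS.
    exact: leq_trans (ltn_ord j) n2.
  by rewrite (E (phi_fun _)).
rewrite !val_phi_fun //; have lin := ltn_ord i; case: (ltnP i 2) => i2.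
  by case: (nat_of_ord i) i2 => [|[|]].
have -> : (n + 1 - i < 2) = false.
  by apply/negbTE; rewrite -leqNgt ltn_subRL ltn_add2r.
by rewrite subKn // addn1 leqW // ltnW.
Qed.

Definition phi : 'S_n := perm (inv_inj phi_funK).

Lemma phi2 : phi ^+ 2 = 1.
Proof. by apply/permP => i; rewrite expgS expg1 permM !permE phi_funK. Qed.

Lemma conn_setV : conn_set^-1 = conn_set.
Proof.
have tV : transp12^-1 = transp12.
  rewrite /transp12; case: (n) => [|[|m]]; rewrite ?invg1 //; exact: tpermV.
apply/setP => s; rewrite mem_invg !inE ![s^-1 == _](inv_eq invgK) invgK tV.
by case: (s == ncycle); rewrite ?orbT ?orbF.
Qed.

End Symmetric.

Lemma conn_set1 n : 2 < n -> 1 \notin conn_set n.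
Proof.
case: n => [|[|n]] // n2.
have c1 : 1 != ncycle n.+2.
  apply/eqP => /permP/(_ ord0)/(congr1 val); rewrite perm1 permE /=.
  by rewrite modn_small.
rewrite !inE !negb_or c1 [1 == _^-1]eq_sym eq_invg1 eq_sym c1 /=.
apply/eqP => /permP/(_ (inord 0))/(congr1 val); rewrite perm1 tpermL.
by rewrite /= !inordK.
Qed.

(* Main.v *)
(** Write c for the n-cycle and t for (1 2). Since the right translations are
    automorphisms, it suffices to show that a graph automorphism f fixing 1 is
    a group automorphism; this holds as soon as the label in {c, c^-1, t} of the
    image under f of an edge depends only on the label of the edge.

    As n >= 13, a word of length at most 12 in c, c^-1 and t cannot wind around
    the n-cycle, so whether it is trivial does not depend on n and is decided by
    finitely many computations. Every corner formed by a t-edge and a c-edge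
    lies on at least two non-backtracking closed walks of length 12, rotations
    of (t c t c^-1)^3 and of (t c^2 t c^-2)^2, but a corner formed by two
    c-edges lies on only one, a rotation of the latter. Hence f maps t-edges to
    t-edges, and at each vertex it either preserves or reverses the direction of
    the c-edges. The choice is the same at both ends of a c-edge, and also at
    both ends of a t-edge, because t c^e1 t c^e2 ... t c^e6 = 1 with all ei = +-1
    forces e1 = - e6. Finally, a group automorphism that fixes t and maps c to c
    or c^-1 is the identity or the conjugation by phi. *)
Require Import Defs.
From mathcomp Require Import all_boot all_fingroup zmodp zify.

Set Implicit Arguments.
Unset Strict Implicit.
Unset Printing Implicit Defensive.

Local Open Scope group_scope.

Lemma gen_ind (gT : finGroupType) (X : {set gT}) (P : gT -> Prop) :
    P 1 -> (forall x g, x \in X -> g \in <<X>> -> P g -> P (x * g)) ->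
  forall g, g \in <<X>> -> P g.
Proof.
move=> P1 PM g /gen_prodgP[k [x Xx ->]]; elim: k x Xx => [|k IH] x Xx.
  by rewrite big_ord0.
rewrite big_ord_recl; apply: PM; [exact: Xx | | by apply: IH => i].
by apply: group_prod => i _; apply: mem_gen.
Qed.

Lemma eq_Aut_gen (gT : finGroupType) (X : {set gT}) (a b : {perm gT}) :
  a \in Aut <<X>> -> b \in Aut <<X>> -> {in X, a =1 b} -> a = b.
Proof.
move=> Aa Ab eqX; apply: eq_Aut (Aa) (Ab) _; rewrite -(autmE Aa) -(autmE Ab).
apply: gen_ind => [|x g Xx Gg eq_g]; first by rewrite !morph1.
by have Gx := mem_gen Xx; rewrite !morphM //= eq_g !autmE eqX.
Qed.

Lemma conjg_mul_expgV (gT : finGroupType) (x y : gT) k :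
  (x ^ y * x) ^+ k = 1 -> (x ^ y^-1 * x) ^+ k = 1.
Proof.
have -> : x ^ y^-1 * x = (x ^ y * x) ^ (x^-1 * y^-1).
  by rewrite conjgM (conjgE _ x^-1) mulgK invgK conjMg conjgK.
by rewrite -conjXg => ->; rewrite conj1g.
Qed.

Section Transpositions.

Variable T : finType.
Implicit Types x y z u : T.

Lemma tperm_braid x y z :
  uniq [:: x; y; z] -> (tperm x y * tperm y z) ^+ 3 = 1.
Proof.
rewrite /= !inE negb_or andbT => /andP[/andP[xy xz] yz].
set a := tperm x y; set b := tperm y z.
have -> : (a * b) ^+ 3 = b ^ a * a ^ b.
  by rewrite !conjgE !tpermV !expgS expg0 mulg1 !mulgA.
by rewrite !tpermJ tpermL tpermR !tpermD // 1?eq_sym // tperm2.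
Qed.

Lemma tperm_disjoint x y z u :
  uniq [:: x; y; z; u] -> (tperm x y * tperm z u) ^+ 2 = 1.
Proof.
rewrite /= !inE !negb_or andbT => /and3P[/and3P[_ xz xu] /andP[yz yu] _].
rewrite expgMn; first by rewrite !expg2 !tperm2 mulg1.
by apply/commgP/conjg_fixP; rewrite tpermJ !tpermD // eq_sym.
Qed.

End Transpositions.

Section RightRegular.

Variable gT : finGroupType.

Lemma right_regularE : right_regular gT = actperm 'R @* [set: gT].
Proof.
have eqR g : perm (@mulIg gT g) = actperm 'R g.
  by apply/permP => x; rewrite permE actpermE.
rewrite morphimEdom; apply/setP => p.
by apply/imsetP/imsetP => -[g _ ->]; exists g.
Qed.

Lemma right_regular_atrans : [transitive right_regular gT, on setT | 'P].
Proof.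
apply/imsetP; exists 1 => //; apply/esym/setP => x; rewrite !inE.
apply/orbitP; exists (perm (@mulIg gT x)); first exact: imset_f.
by rewrite /= apermE permE mul1g.
Qed.

Lemma Aut_fix1 (a : {perm gT}) : a \in Aut [set: gT] -> a 1 = 1.
Proof. by move=> Aa; rewrite -(autmE Aa) morph1. Qed.

Lemma Aut_norm_right_regular : Aut [set: gT] \subset 'N(right_regular gT).
Proof.
apply/subsetP => a Aa; rewrite inE.
apply/subsetP => _ /imsetP[_ /imsetP[g _ ->] ->].
apply/imsetP; exists (a g) => //; apply/permP => x.
rewrite conjgE !permM !(permE (@mulIg _ _)) -{1}(autmE Aa) morphM ?inE //=.
by rewrite autmE permKV.
Qed.

Lemma right_regular_Aut_TI : right_regular gT :&: Aut [set: gT] = 1.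
Proof.
apply/trivgP/subsetP => _ /setIP[/imsetP[g _ ->] Aa].
have := Aut_fix1 Aa; rewrite permE mul1g => ->.
by apply/set1P/permP => x; rewrite permE perm1 mulg1.
Qed.

Section SemidirectProduct.

Variables (aT : finGroupType) (to : groupAction [set: aT] [set: gT]).

Lemma right_regular_morph_act :
  {in [set: gT] & [set: aT], morph_act to 'J (actperm 'R) (actperm to)}.
Proof.
move=> g a _ _; apply/permP => x.
rewrite /= conjgE !permM !actpermE /= -morphV ?inE // actpermE.
by rewrite gactM ?inE // actKVin ?inE.
Qed.

Lemma right_regular_sdprod_isog (G : {group {perm gT}}) :
    'injm (actperm to) -> right_regular gT ><| actperm to @* setT = G ->
  G \isog [set: sdprod_by to].
Proof.
rewrite right_regularE => injto defG; have [_ defRA _ tiRA] := sdprodP defG.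
have injR : 'injm (actperm (mulgr_action gT)) by rewrite ker_actperm astabR.
have inj : 'injm (xsdprodm right_regular_morph_act).
  by rewrite injm_xsdprodm injR injto tiRA eqxx.
have <- : xsdprodm right_regular_morph_act @* setT = G by rewrite im_xsdprodm.
by rewrite isog_sym sub_isog.
Qed.

End SemidirectProduct.

Section Involution.

Variables (t : gT) (t2 : t ^+ 2 = 1).

Lemma actperm_Z2_conj1 :
  actperm (Z2_conj_action t2) Zp1 = conj_aut [set: gT] t.
Proof. by apply/permP => x; rewrite actpermE conj_autE ?inE. Qed.

Lemma im_Z2_conj_actperm :
  actperm (Z2_conj_action t2) @* [set: 'Z_2] = <[conj_aut [set: gT] t]>.
Proof.
rewrite -actperm_Z2_conj1 -morphim_cycle ?inE //.
by congr (_ @* _); apply: Zp_cycle.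
Qed.

Lemma injm_Z2_conj_actperm :
  conj_aut [set: gT] t != 1 -> 'injm (actperm (Z2_conj_action t2)).
Proof.
rewrite -actperm_Z2_conj1 => s1; apply/subsetP => a /mker a1; rewrite inE.
apply: contraNT s1 => a_neq0; rewrite -a1; apply/eqP; congr (actperm _ _).
by apply: val_inj; case: a a_neq0 {a1} => [[|[|]]].
Qed.

End Involution.

End RightRegular.

Section CayleyAutomorphisms.

Variables (gT : finGroupType) (S : {set gT}).

Lemma right_regular_sub_graph_aut :
  right_regular gT \subset graph_aut (cayley S).
Proof.
apply/subsetP => _ /imsetP[g _ ->]; apply/graph_autP => x y.
by rewrite /cayley !permE invMg mulgA mulgK.
Qed.

Lemma Aut_stabE : Aut_stab S = Aut [set: gT] :&: graph_aut (cayley S).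
Proof.
apply/setP => a; rewrite in_setI inE; apply: andb_id2l => Aa.
have aS x : (a x \in a @: S) = (x \in S).
  by rewrite mem_imset //; apply: perm_inj.
have adjE x y : cayley S (a x) (a y) = (a (y * x^-1) \in S).
  by rewrite -(autmE Aa) morphM ?morphV ?inE.
apply/eqP/graph_autP => [eqS x y | eqS]; first by rewrite adjE -{1}eqS aS.
apply/setP => y; rewrite -[y](permKV a) aS.
by have := eqS 1 ((a^-1) y); rewrite adjE /cayley invg1 mulg1.
Qed.

Lemma Aut_stab_sdprod :
    'C_(graph_aut (cayley S))[1 | 'P] \subset Aut [set: gT] ->
  right_regular gT ><| Aut_stab S = graph_aut (cayley S).
Proof.
move=> sCA; have sAA : Aut_stab S \subset Aut [set: gT].
  by rewrite Aut_stabE subsetIl.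
have nRA := subset_trans sAA (Aut_norm_right_regular gT).
have defA : Aut_stab S = 'C_(graph_aut (cayley S))[1 | 'P].
  have sAC : Aut [set: gT] \subset 'C[1 | 'P].
    by apply/subsetP => a Aa; apply/astab1P; rewrite /= apermE Aut_fix1.
  by rewrite Aut_stabE -[RHS](setIidPr sCA) setICA (setIidPl sAC) setIC.
rewrite sdprodE //; last first.
  by apply/trivgP; rewrite -(right_regular_Aut_TI gT) setIS.
rewrite -(normC nRA) defA.
have transR := right_regular_atrans gT.
apply/(subgroup_transitiveP (in_setT 1) right_regular_sub_graph_aut) => //.
rewrite (atrans_supgroup right_regular_sub_graph_aut transR).
by apply/subsetP => a _; rewrite !inE; apply/subsetP => x _; rewrite !inE.
Qed.

End CayleyAutomorphisms.

Section Walks.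

Variable gT : finGroupType.
Implicit Types (S X : {set gT}) (g h x y z : gT) (v w : seq gT).

(* The walk reading w from g ends at [word_prod w * g], since a step along x
   multiplies by x on the left: the first letter comes last. *)
Fixpoint word_prod w : gT := if w is x :: w' then word_prod w' * x else 1.

Lemma word_prod_cat v w : word_prod (v ++ w) = word_prod w * word_prod v.
Proof. by elim: v => [|x v IH] /=; rewrite ?mulg1 // IH mulgA. Qed.

Lemma word_prod_rcons w x : word_prod (rcons w x) = x * word_prod w.
Proof. by rewrite -cats1 word_prod_cat /= mul1g. Qed.

Lemma word_prod_flatten_nseq k w :
  word_prod (flatten (nseq k w)) = word_prod w ^+ k.
Proof. by elim: k => //= k IH; rewrite word_prod_cat IH expgSr. Qed.

Definition nonbacktracking : rel gT := fun x y => y != x^-1.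

(* The non-backtracking closed walks of Cay(G, S) that leave their base point
   along the edge x and return to it along the edge y, with the word v read in
   between. *)
Definition corner_walk S x y v :=
  let w := rcons v y^-1 in
  [&& all (mem S) (x :: w), path nonbacktracking x w & word_prod (x :: w) == 1].

Section Image.

Variable f : {perm gT}.

Definition edge_image g x := f (x * g) * (f g)^-1.

Fixpoint image_word g w : seq gT :=
  if w is x :: w' then edge_image g x :: image_word (x * g) w' else [::].

Lemma edge_imageE g x : f (x * g) = edge_image g x * f g.
Proof. by rewrite mulgKV. Qed.

Lemma edge_image_inj g : injective (edge_image g).
Proof. by move=> x y /mulIg/perm_inj/mulIg. Qed.

Lemma edge_image_onto g z : exists x, edge_image g x = z.
Proof.
exists ((f^-1) (z * f g) * g^-1).
by rewrite /edge_image mulgKV permKV mulgK.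
Qed.

Lemma edge_imageV g x : edge_image (x * g) x^-1 = (edge_image g x)^-1.
Proof. by rewrite /edge_image mulKg invMg invgK. Qed.

Lemma edge_image_eqV g x y :
  (edge_image (x * g) y == (edge_image g x)^-1) = (y == x^-1).
Proof. by rewrite -edge_imageV (inj_eq (@edge_image_inj _)). Qed.

Lemma size_image_word g w : size (image_word g w) = size w.
Proof. by elim: w g => //= x w IH g; rewrite IH. Qed.

Lemma image_word_inj g : injective (image_word g).
Proof.
move=> v w; elim: v g w => [|x v IH] g [|y w] //= [/edge_image_inj <-].
by move/IH ->.
Qed.

Lemma image_word_rcons g w x :
  image_word g (rcons w x)
  = rcons (image_word g w) (edge_image (word_prod w * g) x).
Proof. by elim: w g => [|y w IH] g /=; rewrite ?mul1g // IH mulgA. Qed.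

Lemma word_prod_image g w :
  word_prod (image_word g w) * f g = f (word_prod w * g).
Proof.
by elim: w g => [|x w IH] g /=; rewrite ?mul1g // -mulgA -edge_imageE IH mulgA.
Qed.

Lemma word_prod_image1 g w : word_prod w = 1 -> word_prod (image_word g w) = 1.
Proof.
by move=> w1; apply: (mulIg (f g)); rewrite word_prod_image w1 !mul1g.
Qed.

Lemma last_image_closed g w d :
    word_prod w = 1 -> w != [::] ->
  last d (image_word g w) = (edge_image g (last d w)^-1)^-1.
Proof.
case/lastP: w => // w x; rewrite word_prod_rcons image_word_rcons !last_rcons.
by move/eqP; rewrite -eq_invg_mul => /eqP <- _; rewrite -edge_imageV invgK.
Qed.

Lemma path_image_word g x w :
  path nonbacktracking (edge_image g x) (image_word (x * g) w)
  = path nonbacktracking x w.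
Proof.
by elim: w g x => //= y w IH g x; rewrite IH /nonbacktracking edge_image_eqV.
Qed.

Lemma edge_image_Aut X :
    f 1 = 1 -> <<X>> = [set: gT] ->
    {in X &, forall x y g, edge_image (y * g) x = edge_image g x} ->
  f \in Aut [set: gT].
Proof.
move=> f1 genX constX.
have imX x : x \in X -> forall g, edge_image g x = f x.
  move=> Xx g; have: g \in <<X>> by rewrite genX inE.
  apply: (gen_ind (P := fun g => edge_image g x = f x)).
    by rewrite /edge_image f1 invg1 !mulg1.
  by move=> y h Xy _ <-; apply: constX.
rewrite inE; apply/andP; split; first by apply/subsetP => x _; rewrite inE.
apply/morphicP => h g _ _; have: h \in <<X>> by rewrite genX inE.
apply: (gen_ind (P := fun h => f (h * g) = f h * f g)).
  by rewrite f1 !mul1g.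
by move=> x {}h Xx _ IH; rewrite -mulgA !(edge_imageE _ x) !imX // IH mulgA.
Qed.

Section GraphAutomorphism.

Variable S : {set gT}.
Hypothesis autf : f \in graph_aut (cayley S).

Lemma edge_image_mem g x : (edge_image g x \in S) = (x \in S).
Proof. by have /graph_autP/(_ g (x * g)) := autf; rewrite /cayley mulgK. Qed.

Lemma all_image_word g w : all (mem S) (image_word g w) = all (mem S) w.
Proof. by elim: w g => //= x w IH g; rewrite IH edge_image_mem. Qed.

Lemma corner_walk_image g x y v :
  corner_walk S x y v ->
  corner_walk S (edge_image g x) (edge_image g y) (image_word (x * g) v).
Proof.
case/and3P=> Sw nbw /eqP w1; set w := rcons v y^-1.
have imw : image_word (x * g) w
    = rcons (image_word (x * g) v) (edge_image g y)^-1.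
  rewrite image_word_rcons; congr rcons.
  have := last_image_closed g 1 w1 isT.
  by rewrite /= last_rcons invgK image_word_rcons last_rcons.
have im1 := word_prod_image1 g w1.
apply/and3P; rewrite -imw path_image_word -[_ :: _]/(image_word g (x :: w)).
by rewrite all_image_word im1.
Qed.

End GraphAutomorphism.

End Image.

End Walks.

(* [None] stands for t, [Some true] for c and [Some false] for c^-1. *)
Definition letter := option bool.

Definition letter_inv (x : letter) : letter := omap negb x.

Definition letter_nonbacktracking : rel letter := fun x y => y != letter_inv x.

(* The letters of a word act on a point from the last one to the first. The
   natural number p represents the point c^p(o), where o is such that t
   exchanges c^m(o) and c^(m+1)(o). A step is undefined when it leaves the
   window in which, for every n > m, only m and m + 1 represent these points. *)
Definition window_step m (x : letter) (p : nat) : option nat :=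
  match x with
  | Some true => Some p.+1
  | Some false => if p is q.+1 then Some q else None
  | None => if 0 < p <= m.*2
            then Some (if p == m then m.+1 else if p == m.+1 then m else p)
            else None
  end.

Definition window_run m (u : seq letter) p :=
  foldr (fun x => obind (window_step m x)) (Some p) u.

(* The bounds ensure that p and q represent different points for all n > m. *)
Definition displaces_at m (u : seq letter) p :=
  if window_run m u p is Some q then [&& q != p, q <= p + m & p <= q + m]
  else false.

Definition displaces m (u : seq letter) := has (displaces_at m u) (iota 1 m.*2).

Fixpoint nonbacktracking_words k (x : letter) : seq (seq letter) :=
  if k is k'.+1 then
    [seq y :: u | y <- [seq y <- [:: None; Some true; Some false]
                          | letter_nonbacktracking x y],
                  u <- nonbacktracking_words k' y]
  else [:: [::]].

Lemma mem_nonbacktracking_words x u :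
  path letter_nonbacktracking x u -> u \in nonbacktracking_words (size u) x.
Proof.
elim: u x => [|y u IH] x; first by rewrite inE.
case/andP=> xy /IH yu.
apply/allpairsPdep; exists y, u; rewrite mem_filter xy yu.
by case: (y) => [[]|].
Qed.

(* (t c t c^-1)^3 and (t c^2 t c^-2)^2, or with c^-1 in place of c. *)
Definition braid_word e : seq letter :=
  flatten (nseq 3 [:: None; Some e; None; Some (~~ e)]).

Definition commutation_word e : seq letter :=
  flatten (nseq 2 [:: None; Some e; Some e; None; Some (~~ e); Some (~~ e)]).

Definition alternating_word (es : seq bool) : seq letter :=
  flatten [seq [:: None; Some e] | e <- es].

Definition inner_word (u : seq letter) := behead (take (size u).-1 u).

(* The commutation relation, read from a corner between two c-edges. *)
Definition turn_word b := rotr 1 (commutation_word (~~ b)).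

Lemma turn_word_or_displaces b :
  all (fun u => [|| last (Some b) u == Some (~~ b),
                    u == inner_word (turn_word b)
                  | displaces 12 (Some b :: rcons u (Some b))])
      (nonbacktracking_words 10 (Some b)).
Proof. by case: b; vm_compute. Qed.

Lemma alternating_word_displaces es :
    size es = 6 -> head false es = last false es ->
  displaces 12 (alternating_word es).
Proof.
case: es => [|e1 [|e2 [|e3 [|e4 [|e5 [|e6 [|]]]]]]] // _ /= <-.
by case: e1; case: e2; case: e3; case: e4; case: e5; vm_compute.
Qed.

Section Letters.

Variable n : nat.

Local Notation c := (ncycle n).
Local Notation t := (transp12 n).

Lemma val_ncycleX k (i : 'I_n) : (c ^+ k) i = (i + k) %% n :> nat.
Proof.
elim: k => [|k IH]; first by rewrite perm1 addn0 modn_small.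
by rewrite expgSr permM permE /= IH -addn1 modnDml addn1 addnS.
Qed.

Lemma ncycleX_eq (i : 'I_n) p q :
  p < q + n -> q < p + n -> ((c ^+ p) i == (c ^+ q) i) = (p == q).
Proof.
rewrite -val_eqE /= !val_ncycleX eqn_modDl.
wlog pq : p q / p <= q => [W|] ltpq ltqp.
  by case: (leqP p q) => [|/ltnW] ?; last rewrite eq_sym [RHS]eq_sym; apply: W.
rewrite eq_sym eqn_mod_dvd //; have [->|neq_pq] := eqVneq p q.
  by rewrite subnn dvdn0.
by rewrite gtnNdvd //; lia.
Qed.

Lemma uniq_ncycleX (i : 'I_n) ks :
  all (gtn n) ks -> uniq [seq (c ^+ k) i | k <- ks] = uniq ks.
Proof.
move/allP=> ltks; apply: map_inj_in_uniq => p q /ltks ltpn /ltks ltqn /eqP.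
by rewrite ncycleX_eq ?ltn_addl // => /eqP.
Qed.

Lemma tpermJ_ncycleX (i : 'I_n) p q k :
  tperm ((c ^+ p) i) ((c ^+ q) i) ^ (c ^+ k)
  = tperm ((c ^+ (p + k)) i) ((c ^+ (q + k)) i).
Proof. by rewrite tpermJ -!permM -!expgD. Qed.

Lemma transp12E : 1 < n -> exists2 z : 'I_n, z = 0 :> nat & t = tperm z (c z).
Proof.
rewrite /ncycle /transp12; case: n => [|[|m]] // _.
exists (inord 0); first by rewrite inordK.
by congr tperm; apply: val_inj; rewrite permE /= !inordK ?modn_small.
Qed.

Lemma transp12_ncycleX k :
  1 < n -> exists o, t = tperm ((c ^+ k) o) ((c ^+ k.+1) o).
Proof.
case/transp12E=> z _ ->; exists ((c ^- k) z).
by rewrite expgSr !permM permKV.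
Qed.

Lemma transp12V : t^-1 = t.
Proof. by rewrite /transp12; case: n => [|[|m]]; rewrite ?invg1 ?tpermV. Qed.

Lemma gen_transp12_ncycle : 1 < n -> <<[set t; c]>> = [set: 'S_n].
Proof.
rewrite /ncycle /transp12; case: n => [|[|m]] // _.
have co : coprime m.+2 (@inord m.+1 1 - inord 0)%R.
  by rewrite /= !inordK // subn0 modnn addn0 modn_small // coprimen1.
rewrite -(gen_tpermn_circular_shift co); congr (<<[set _; _]>>).
by apply/permP => i; apply: val_inj; rewrite !permE /= add1n.
Qed.

Definition letter_perm (x : letter) : 'S_n :=
  match x with None => t | Some true => c | Some false => c^-1 end.

Lemma letter_perm_inv x : letter_perm (letter_inv x) = (letter_perm x)^-1.
Proof. by case: x => [[]|] /=; rewrite ?invgK ?transp12V. Qed.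

Lemma letter_perm_inj : 2 < n -> injective letter_perm.
Proof.
move=> n_gt2; have [|o tE] := @transp12_ncycleX 0; first exact: ltnW.
have c2 : c (c o) != o.
  by have := @ncycleX_eq o 2 0; rewrite !permM perm1 => ->; lia.
have cV : c^-1 != c.
  by apply: contraNneq c2 => cV; rewrite -{1}cV permK.
have tc : t != c.
  by apply: contraNneq c2 => tc; rewrite -{1}tc tE expg1 expg0 perm1 tpermR.
have tcV : t != c^-1 by rewrite -transp12V (inj_eq invg_inj).
move=> x y; apply: contra_eq.
by case: x y => [[]|] [[]|] //= _; rewrite // eq_sym.
Qed.

Lemma conn_setP s : reflect (exists x, s = letter_perm x) (s \in conn_set n).
Proof.
rewrite !inE -orbA; apply: (iffP or3P) => [[] /eqP->|[[[]|] ->]].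
- by exists (Some true).
- by exists (Some false).
- by exists None.
- by constructor 1.
- by constructor 2.
- by constructor 3.
Qed.

Lemma conn_set_wordP (w : seq 'S_n) :
  reflect (exists u, w = map letter_perm u) (all (mem (conn_set n)) w).
Proof.
apply: (iffP idP) => [|[u ->]]; last first.
  by rewrite all_map; apply/allP => x _; apply/conn_setP; exists x.
elim: w => [|s w IH] /=; first by exists [::].
by case/andP=> /conn_setP[x ->] /IH[u ->]; exists (x :: u).
Qed.

Definition word_perm (u : seq letter) : 'S_n := word_prod (map letter_perm u).

Lemma corner_walk_letter_perm x y u :
    2 < n ->
  corner_walk (conn_set n) (letter_perm x) (letter_perm y) (map letter_perm u)
  = path letter_nonbacktracking x (rcons u (letter_inv y))
    && (word_perm (x :: rcons u (letter_inv y)) == 1).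
Proof.
move=> n_gt2; rewrite /corner_walk -letter_perm_inv -map_rcons -map_cons.
rewrite (introT (conn_set_wordP _)) /=; last first.
  by exists (x :: rcons u (letter_inv y)).
rewrite path_map; congr andb; apply: eq_path => a b /=.
by rewrite /nonbacktracking -letter_perm_inv (inj_eq (letter_perm_inj n_gt2)).
Qed.

Lemma braid_word1 e : 2 < n -> word_perm (braid_word e) = 1.
Proof.
move=> n_gt2; rewrite /word_perm map_flatten map_nseq word_prod_flatten_nseq.
suff ct1 : (t ^ (c ^+ 1) * t) ^+ 3 = 1.
  have: (t ^ letter_perm (Some e) * t) ^+ 3 = 1.
    by case: e => //; apply: conjg_mul_expgV.
  by rewrite conjgE -letter_perm_inv /= mul1g !mulgA.
have [o ->] := transp12_ncycleX 0 (ltnW n_gt2).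
rewrite tpermJ_ncycleX tpermC [X in _ * X]tpermC.
by apply: tperm_braid; rewrite (@uniq_ncycleX _ [:: 2; 1; 0]%N) //=; lia.
Qed.

Lemma commutation_word1 e : 3 < n -> word_perm (commutation_word e) = 1.
Proof.
move=> n_gt3; rewrite /word_perm map_flatten map_nseq word_prod_flatten_nseq.
suff ct1 : (t ^ (c ^+ 2) * t) ^+ 2 = 1.
  have: (t ^ (letter_perm (Some e) ^+ 2) * t) ^+ 2 = 1.
    by case: e => //=; rewrite expgVn; apply: conjg_mul_expgV.
  by rewrite conjgE -expgVn -letter_perm_inv !expg2 /= mul1g !mulgA.
have [|o ->] := @transp12_ncycleX 0; first by lia.
rewrite tpermJ_ncycleX.
by apply: tperm_disjoint; rewrite (@uniq_ncycleX _ [:: 2; 3; 0; 1]%N) //=; lia.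
Qed.

Lemma braid_corner_walk e :
    2 < n ->
  corner_walk (conn_set n) t (letter_perm (Some e))
    (map letter_perm (inner_word (braid_word e))).
Proof.
move=> n_gt2; rewrite (@corner_walk_letter_perm None) //.
by apply/andP; split; [case: e | apply/eqP/braid_word1].
Qed.

Lemma commutation_corner_walk e :
    3 < n ->
  corner_walk (conn_set n) t (letter_perm (Some e))
    (map letter_perm (inner_word (commutation_word e))).
Proof.
move=> n_gt3; rewrite (@corner_walk_letter_perm None) ?(ltnW n_gt3) //.
by apply/andP; split; [case: e | apply/eqP/commutation_word1].
Qed.

Section Window.

Variables (m : nat) (o : 'I_n).
Hypothesis m_lt_n : m < n.
Hypothesis transp12_o : t = tperm ((c ^+ m) o) ((c ^+ m.+1) o).

Lemma window_stepP x p q :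
  window_step m x p = Some q -> letter_perm x ((c ^+ p) o) = (c ^+ q) o.
Proof.
case: x => [[]|] /=.
- by case=> <-; rewrite expgSr permM.
- by case: p => // p [<-]; rewrite expgSr permM permK.
case: ifP => // /andP[p_gt0 p_le] [<-]; rewrite transp12_o.
have [->|p_neq_m] := eqVneq p m; first by rewrite tpermL.
have [->|p_neq_m1] := eqVneq p m.+1; first by rewrite tpermR.
by rewrite tpermD // ncycleX_eq 1?eq_sym //; lia.
Qed.

Lemma window_runP u p q :
  window_run m u p = Some q -> word_perm u ((c ^+ p) o) = (c ^+ q) o.
Proof.
elim: u q => [|x u IH] q /=; first by case=> ->; rewrite perm1.
case run_u: (window_run m u p) => [r|] //= /window_stepP <-.
by rewrite /word_perm /= permM -/(word_perm u) (IH r).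
Qed.

End Window.

Lemma displaces_neq1 m u : m < n -> displaces m u -> word_perm u != 1.
Proof.
move=> m_lt_n /hasP[p]; rewrite mem_iota => p_bounds.
have [|o transp12_o] := @transp12_ncycleX m; first by lia.
rewrite /displaces_at; case run_u: window_run => [q|] //.
case/and3P=> q_neq_p q_le p_le.
apply: contraNneq q_neq_p => u1; have := window_runP m_lt_n transp12_o run_u.
by rewrite u1 perm1 => /eqP; rewrite eq_sym ncycleX_eq //; lia.
Qed.

Section DegreeBound.

Hypothesis n_gt12 : 12 < n.

Lemma turn_corner_walk_unique b v :
    size v = 10 ->
    corner_walk (conn_set n) (letter_perm (Some b)) (letter_perm (Some (~~ b)))
      v ->
  v = map letter_perm (inner_word (turn_word b)).
Proof.
have n_gt2 : 2 < n by apply: leq_trans n_gt12.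
move=> szv cornv; have [u Ev] : exists u, v = map letter_perm u.
  apply/conn_set_wordP; have /and3P[+ _ _] := cornv.
  by rewrite /= all_rcons => /and3P[].
rewrite {v}Ev size_map in szv cornv *; move: cornv.
rewrite corner_walk_letter_perm // [letter_inv _]/= negbK rcons_path.
case/andP=> /andP[nbu nb_last] u1.
have := mem_nonbacktracking_words nbu; rewrite szv.
case/(allP (turn_word_or_displaces b))/or3P=> [/eqP lastu|/eqP->//|].
  by rewrite lastu /letter_nonbacktracking /= negbK eqxx in nb_last.
by move/(displaces_neq1 n_gt12); rewrite u1.
Qed.

Lemma alternating_word_closed es :
    size es = 6 -> word_perm (alternating_word es) = 1 ->
  head false es = ~~ last false es.
Proof.
move=> sz6 es1; have [eq_ends|] := eqVneq (head false es) (last false es).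
  have := displaces_neq1 n_gt12 (alternating_word_displaces sz6 eq_ends).
  by rewrite es1 eqxx.
by case: head; case: last.
Qed.

End DegreeBound.

End Letters.

Arguments letter_perm {n} x.
Arguments word_perm {n} u.

Section Reflection.

Variable n : nat.
Hypothesis n_gt1 : 1 < n.

Local Notation c := (ncycle n).
Local Notation t := (transp12 n).

Lemma val_phi (i : 'I_n) :
  phi n i = (if i < 2 then 1 - i else n + 1 - i)%N :> nat.
Proof. by rewrite permE val_phi_fun. Qed.

Lemma ncycleJ_phi : c ^ phi n = c^-1.
Proof.
have val_c (i : 'I_n) : c i = (if i.+1 == n then 0 else i.+1)%N :> nat.
  have := val_ncycleX 1 i; rewrite expg1 addn1 => ->; have := ltn_ord i.
  by case: eqP => [->|ne] ltin; rewrite ?modnn ?modn_small //; lia.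
have phiV : (phi n)^-1 = phi n.
  by apply/eqP; rewrite eq_invg_mul -expg2 phi2.
rewrite conjgE phiV; apply/eqP; rewrite eq_sym eq_invg_mul; apply/eqP.
apply/permP => i; apply: ord_inj; rewrite !permM perm1.
rewrite val_phi val_c val_phi val_c; have := ltn_ord i.
by repeat case: ifP; lia.
Qed.

Lemma transp12J_phi : t ^ phi n = t.
Proof.
have [z z0 ->] := transp12E n_gt1; rewrite tpermJ tpermC.
have z1 : c z = 1%N :> nat.
  by have := val_ncycleX 1 z; rewrite expg1 z0 modn_small.
by congr tperm; apply: ord_inj; rewrite val_phi ?z1 ?z0.
Qed.

Lemma conj_phi_Aut_stab :
  conj_aut [set: 'S_n] (phi n) \in Aut_stab (conn_set n).
Proof.
rewrite inE Aut_aut /= eqEcard card_imset ?leqnn ?andbT; last exact: perm_inj.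
apply/subsetP => _ /imsetP[g + ->]; rewrite conj_autE ?inE //= -orbA.
by case/or3P=> /eqP->;
  rewrite ?conjVg ?ncycleJ_phi ?transp12J_phi ?invgK eqxx ?orbT.
Qed.

End Reflection.

Lemma conj_phi_neq1 n : 2 < n -> conj_aut [set: 'S_n] (phi n) != 1.
Proof.
move=> n_gt2; apply/eqP => /permP/(_ (ncycle n)).
rewrite conj_autE ?inE // perm1 ncycleJ_phi ?(ltnW n_gt2) //.
by move/(@letter_perm_inj _ n_gt2 (Some false) (Some true)).
Qed.

Section GraphAutomorphisms.

Variable n : nat.
Hypothesis n_gt12 : 12 < n.

Local Notation c := (ncycle n).
Local Notation t := (transp12 n).
Local Notation S := (conn_set n).

Let n_gt3 : 3 < n. Proof. exact: leq_trans n_gt12. Qed.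
Let n_gt2 : 2 < n := ltnW n_gt3.
Let letter_permI : injective (@letter_perm n) := letter_perm_inj n_gt2.

Section EdgeImages.

Variable f : {perm 'S_n}.
Hypothesis autf : f \in graph_aut (cayley S).

Local Notation img := (edge_image f).

Lemma edge_image_letter g x : exists y, img g (letter_perm x) = letter_perm y.
Proof.
by apply/conn_setP; rewrite edge_image_mem //; apply/conn_setP; exists x.
Qed.

Lemma edge_image_transp12 g : img g t = t.
Proof.
have [[b|] // imt] := edge_image_letter g None.
have [s ims] := edge_image_onto f g (letter_perm (Some (~~ b))).
have /conn_setP[[e|] Es] : s \in S.
- rewrite -(edge_image_mem autf g) ims.
  by apply/conn_setP; exists (Some (~~ b)).
- have inner_image u : size u = 10 ->
      corner_walk S t (letter_perm (Some e)) (map letter_perm u) ->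
    image_word f (t * g) (map letter_perm u)
    = map letter_perm (inner_word (turn_word b)).
    move=> szu /(corner_walk_image autf g).
    rewrite imt -Es ims => /turn_corner_walk_unique-> //.
    by rewrite size_image_word size_map.
  have /inner_image := braid_corner_walk e n_gt2.
  have /inner_image <- // := commutation_corner_walk e n_gt3.
  by move=> /(_ erefl)/image_word_inj/(inj_map (@letter_permI)); case: (e).
- by move: ims; rewrite Es imt => /letter_permI; case: (b).
Qed.

Lemma edge_image_ncycle_sign g e :
  exists b, img g (letter_perm (Some e)) = letter_perm (Some b).
Proof.
have [[b|] imc] := edge_image_letter g (Some e); first by exists b.
have /edge_image_inj := etrans imc (esym (edge_image_transp12 g)).
by move/(@letter_permI (Some e) None).
Qed.

Lemma edge_image_ncycleV g : img g c^-1 = (img g c)^-1.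
Proof.
have [b imc] := edge_image_ncycle_sign g true.
have [b' imcV] := edge_image_ncycle_sign g false.
rewrite [LHS]imcV [img g c]imc -letter_perm_inv; congr letter_perm.
have neq_b : b' != b.
  apply/eqP => eq_b; rewrite eq_b -imc in imcV; move: imcV.
  by move/edge_image_inj/(@letter_permI (Some false) (Some true)).
by case: b b' neq_b {imc imcV} => [] [].
Qed.

Lemma edge_image_along_ncycle g : img (c * g) c = img g c.
Proof. by apply: invg_inj; rewrite -edge_image_ncycleV edge_imageV. Qed.

Lemma image_alternating_word g es : exists2 es',
    size es' = size es
  & image_word f g (map letter_perm (alternating_word es))
    = map letter_perm (alternating_word es').
Proof.
elim: es g => [|e es IH] g; first by exists [::].
have [b imc] := edge_image_ncycle_sign (t * g) e.
have [es' sz_es' imes] := IH (letter_perm (Some e) * (t * g)).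
exists (b :: es'); first by rewrite /= sz_es'.
by rewrite /= edge_image_transp12 imc -imes.
Qed.

Lemma edge_image_along_transp12 g : img (t * g) c = img g c.
Proof.
pose es := [:: true; false; true; false; true; false].
have es1 : word_perm (alternating_word es) = 1 :> 'S_n.
  exact: (braid_word1 true n_gt2).
have [es' sz_es' imes] := image_alternating_word g es.
have es'1 : word_perm (alternating_word es') = 1 :> 'S_n.
  by rewrite /word_perm -imes word_prod_image1.
have im_head : img (t * g) c = letter_perm (Some (head false es')).
  by case: es' imes {es'1} sz_es' => // e es' [_ ->].
have im_last : (img g c)^-1 = letter_perm (Some (last false es')).
  have := last_image_closed f g 1 es1 isT.
  rewrite imes [last 1 _]/= invgK => <-.
  case/lastP: es' sz_es' {imes im_head es'1} => // es' e _.
  rewrite /alternating_word map_rcons flatten_rcons map_cat last_cat.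
  by rewrite last_rcons.
have := alternating_word_closed n_gt12 sz_es' es'1.
rewrite im_head => ->; rewrite -[Some _]/(letter_inv (Some _)).
by rewrite letter_perm_inv -im_last invgK.
Qed.

Lemma graph_aut_fix1_Aut : f 1 = 1 -> f \in Aut [set: 'S_n].
Proof.
move=> f1; apply: (@edge_image_Aut _ _ [set t; c]) => //.
  exact: gen_transp12_ncycle (ltnW n_gt2).
move=> x y /set2P[]-> /set2P[]-> g; rewrite ?edge_image_transp12 //.
  exact: edge_image_along_transp12.
exact: edge_image_along_ncycle.
Qed.

End EdgeImages.

Lemma Aut_stab_conn_set :
  Aut_stab S = <[conj_aut [set: 'S_n] (phi n)]>.
Proof.
have n_gt1 := ltnW n_gt2; have genS := gen_transp12_ncycle n_gt1.
apply/eqP; rewrite eqEsubset cycle_subG conj_phi_Aut_stab // andbT.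
apply/subsetP => a; rewrite Aut_stabE => /setIP[Aa auta].
have imE x : edge_image a 1 x = a x.
  by rewrite /edge_image mulg1 Aut_fix1 // invg1 mulg1.
have a_t : a t = t by rewrite -imE edge_image_transp12.
have [[] a_c] := edge_image_ncycle_sign auta 1 true; rewrite imE /= in a_c.
  suff -> : a = 1 by apply: group1.
  apply: (@eq_Aut_gen _ [set t; c]); rewrite ?genS ?group1 //.
  by move=> x /set2P[]->; rewrite perm1.
suff -> : a = conj_aut [set: 'S_n] (phi n) by apply: cycle_id.
apply: (@eq_Aut_gen _ [set t; c]); rewrite ?genS ?Aut_aut //.
by move=> x /set2P[]->; rewrite conj_autE ?inE // ?transp12J_phi ?ncycleJ_phi.
Qed.

End GraphAutomorphisms.

Theorem theorem2p1 (n : nat) (hn : (13 <= n)%N) :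
  [/\ right_regular 'S_n ><| Aut_stab (conn_set n)
        = graph_aut (cayley (conn_set n)),
      Aut_stab (conn_set n) = <[conj_aut [set: 'S_n] (phi n)]>,
      right_regular 'S_n ><| <[conj_aut [set: 'S_n] (phi n)]>
        = graph_aut (cayley (conn_set n))
    & graph_aut (cayley (conn_set n))
        \isog [set: sdprod_by (Z2_conj_groupAction (phi2 n))]].
Proof.
have defA := Aut_stab_conn_set hn.
have defG : right_regular 'S_n ><| Aut_stab (conn_set n)
    = graph_aut (cayley (conn_set n)).
  apply/Aut_stab_sdprod/subsetP => f /setIP[autf /astab1P f1].
  exact: graph_aut_fix1_Aut autf f1.
have defGs := defG; rewrite defA in defGs; split=> //.
apply: right_regular_sdprod_isog; last by rewrite im_Z2_conj_actperm.
by apply/injm_Z2_conj_actperm/conj_phi_neq1; apply: leq_trans hn.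
Qed.
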